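(* Let $\mathcal W=(N,g,\nabla)$ be a Weyl manifold of dimension $n\ge 3$, let $R=R(\nabla)$ be its $g$-associated curvature tensor, and let $\alpha_i(R)$, $\pi_i(R)$ be the components of $R$ in the $A$-decomposition and the $W$-decomposition. Then the following properties are equivalent: (1) $\mathcal W$ is Einstein-Weyl. (2) $R=(\alpha_1+\alpha_6+\alpha_4+\alpha_5)(R)$. (3) $R=(\pi_1+\pi_3+\pi_4+\pi_6)(R)$. (4) $\alpha_2(R)=0$. (5) $\pi_2(R)=0$. (6) $\pi_5(R)=0$. (7) $\operatorname{Ric}(\alpha_2(R))=0$. (8) $\operatorname{Ric}^\star(\alpha_2(R))=0$. (9) $\operatorname{Ric}(\pi_2(R))=0$. (10) $\operatorname{Ric}^\star(\pi_2(R))=0$. (11) $\operatorname{Ric}^\star(\pi_5(R))=0$. (12) $\operatorname{Ric}^\star(\alpha_1(R))=\operatorname{Ric}(R)$. (13) $\operatorname{Ric}(\pi_1(R))=\operatorname{Ric}(R)$. (14) $\operatorname{Ric}^\star(\pi_1(R))=\operatorname{Ric}(R)$. (15) $\operatorname{Ric}(\alpha_1(R))=\operatorname{Ric}(R)$.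
   Context: A Weyl manifold is a triple $(N,g,\nabla)$ with $g$ a semi-Riemannian metric and $\nabla$ a torsion free connection on $TN$ such that $\nabla g=-2\phi\otimes g$ for some smooth $1$-form $\phi$. $\mathcal R(x,y)z:=(\nabla_x\nabla_y-\nabla_y\nabla_x-\nabla_{[x,y]})z$ and $R(x,y,z,w):=g(\mathcal R(x,y)z,w)$. For a $(0,4)$-tensor $A$: $\operatorname{Ric}(A)(x,y):=g^{ij}A(e_i,x,y,e_j)$, $\operatorname{Ric}^\star(A)(x,y):=g^{ij}A(x,e_i,e_j,y)$; $\operatorname{Ric}=\operatorname{Ric}(R)$, $\tau_g:=g^{ij}\operatorname{Ric}(e_i,e_j)$. $S\theta$ and $\Lambda\theta$ denote the symmetrization and anti-symmetrization of a $(0,2)$-tensor, $\theta=S\theta+\Lambda\theta$. $(N,g,\nabla)$ is Einstein-Weyl if $S\operatorname{Ric}=\lambda\cdot g$ for some function $\lambda$ (then $n\lambda=\tau_g$). For bilinear forms: $(\theta_1\cdot\theta_2)(x,y,z,w):=\theta_1(x,y)\theta_2(z,w)$, and for an integer $r$, $(\theta_1\wedge_r\theta_2)(x,y,z,w):=\theta_1(x,z)\theta_2(y,w)-\theta_1(y,z)\theta_2(x,w)-r[\theta_1(x,w)\theta_2(y,z)-\theta_1(y,w)\theta_2(x,z)]$, $\wedge:=\wedge_0$. For the curvature tensor $R$ of a Weyl manifold, the components of the $A$-decomposition are $\alpha_3(R)=\alpha_7(R)=\alpha_8(R)=0$ and $\alpha_1(R)=-\frac{1}{n(n-1)}\tau_g\,g\wedge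 g$, $\alpha_2(R)=-\frac{1}{n-2}S\operatorname{Ric}\wedge_1 g+\frac{2}{n(n-2)}\tau_g\,g\wedge g$, $\alpha_4(R)=-\frac1{2n}(2\Lambda\operatorname{Ric}\cdot g+\Lambda\operatorname{Ric}\wedge_{-1}g)$, $\alpha_5(R)=-\frac1{2n}(2\Lambda\operatorname{Ric}\cdot g+\Lambda\operatorname{Ric}\wedge_3 g)$, $\alpha_6(R)=R+\frac2n\Lambda\operatorname{Ric}\cdot g+\frac1n\Lambda\operatorname{Ric}\wedge_1 g+\frac1{n-2}S\operatorname{Ric}\wedge_1 g-\frac{1}{(n-1)(n-2)}\tau_g\,g\wedge g$. The components of the $W$-decomposition are $\pi_7(R)=\pi_8(R)=0$ and $\pi_1(R)=-\frac1{n(n-1)}\tau_g\,g\wedge g$, $\pi_2(R)=\frac1{n-1}[\frac1n\tau_g g-S\operatorname{Ric}]\wedge g$, $\pi_3(R)=-\frac1{n+1}[2\Lambda\operatorname{Ric}\cdot g+\Lambda\operatorname{Ric}\wedge g]$, $\pi_4(R)=-\frac1{n(n+1)}[2\Lambda\operatorname{Ric}\cdot g+\Lambda\operatorname{Ric}\wedge_{n+1}g]$, $\pi_5(R)=\frac1{(n-1)(n-2)}[\tau_g\,g\wedge g-S\operatorname{Ric}\wedge_{n-1}g]$, $\pi_6(R)=\alpha_6(R)$. In each decomposition $R$ is the sum of its components.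
   Formalization: Literal (12)–(15) force ΛRic=0, which (1) does not imply (Einstein–Weyl Berger spheres with dφ≠0). In the equivalence, (12)–(15) have SRic(R) in place of Ric(R); the literal (12)–(15) are shown equivalent to (1) together with ΛRic=0. *)

(* Defs.v *)
From mathcomp Require Import all_boot all_order all_algebra.
From mathcomp Require Import all_classical all_reals all_analysis.

Set Implicit Arguments.
Unset Strict Implicit.
Unset Printing Implicit Defensive.

Import Order.TTheory GRing.Theory Num.Theory.
Import numFieldNormedType.Exports.

Local Open Scope classical_set_scope.
Local Open Scope ring_scope.

(* Multilinear algebra on one tangent space 'rV_n; g is the Gram matrix of  *)
(* the inner product and A a (0,4)-tensor.                                  *)

Notation form2 R n := ('rV[R]_n -> 'rV[R]_n -> R) (only parsing).
Notation form4 R n :=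
  ('rV[R]_n -> 'rV[R]_n -> 'rV[R]_n -> 'rV[R]_n -> R) (only parsing).

Section Forms.
Context {R : realType} {n : nat}.
Local Notation V := 'rV[R]_n.
Local Notation form2 := (form2 R n).
Local Notation form4 := (form4 R n).

Definition inner (g : 'M[R]_n) : form2 := fun x y => (x *m g *m y^T) 0 0.

Definition basis (i : 'I_n) : V := delta_mx 0 i.

Definition sym (t : form2) : form2 := fun x y => (t x y + t y x) / 2.
Definition alt (t : form2) : form2 := fun x y => (t x y - t y x) / 2.

Definition tens (t1 t2 : form2) : form4 := fun x y z w => t1 x y * t2 z w.

Definition wedge (r : int) (t1 t2 : form2) : form4 := fun x y z w =>
  t1 x z * t2 y w - t1 y z * t2 x w
  - r%:~R * (t1 x w * t2 y z - t1 y w * t2 x z).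

Definition trace (g : 'M[R]_n) (t : form2) : R :=
  \sum_(i < n) \sum_(j < n) invmx g i j * t (basis i) (basis j).

Definition ricci (g : 'M[R]_n) (A : form4) : form2 := fun x y =>
  trace g (fun ei ej => A ei x y ej).

Definition ricci_star (g : 'M[R]_n) (A : form4) : form2 := fun x y =>
  trace g (fun ei ej => A x ei ej y).

Section Components.
Variables (g : 'M[R]_n) (A : form4).
Local Notation m := (n%:R : R).
Local Notation G := (inner g).
Local Notation tau := (trace g (ricci g A)).
Local Notation SRic := (sym (ricci g A)).
Local Notation LRic := (alt (ricci g A)).

Definition alpha1 : form4 := - (tau / (m * (m - 1))) *: wedge 0 G G.

Definition alpha2 : form4 :=
  - (m - 2)^-1 *: wedge 1 SRic G
  + (2 / (m * (m - 2)) * tau) *: wedge 0 G G.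

Definition alpha4 : form4 :=
  - (2 * m)^-1 *: (2 *: tens LRic G + wedge (-1) LRic G).

Definition alpha5 : form4 :=
  - (2 * m)^-1 *: (2 *: tens LRic G + wedge 3 LRic G).

Definition alpha6 : form4 :=
  A + (2 / m) *: tens LRic G + m^-1 *: wedge 1 LRic G
  + (m - 2)^-1 *: wedge 1 SRic G
  - (tau / ((m - 1) * (m - 2))) *: wedge 0 G G.

Definition pi1 : form4 := - (tau / (m * (m - 1))) *: wedge 0 G G.

Definition pi2 : form4 :=
  (m - 1)^-1 *: wedge 0 ((tau / m) *: G - SRic) G.

Definition pi3 : form4 :=
  - (m + 1)^-1 *: (2 *: tens LRic G + wedge 0 LRic G).

Definition pi4 : form4 :=
  - (m * (m + 1))^-1 *: (2 *: tens LRic G + wedge (n%:Z + 1) LRic G).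

Definition pi5 : form4 :=
  ((m - 1) * (m - 2))^-1 *: (tau *: wedge 0 G G - wedge (n%:Z - 1) SRic G).

Definition pi6 : form4 := alpha6.

End Components.
End Forms.

(* All iterated directional derivatives of f are differentiable on the open *)
(* set U.                                                                   *)
Definition smooth_on (R : realType) (V W : normedModType R) (U : set V)
    (f : V -> W) : Prop :=
  forall (s : seq V) (x : V), U x ->
    differentiable (foldr (fun v (h : V -> W) y => 'D_v h y) f s) x.

(* Only the restrictions of cfun to cdom and of cinv to the image of cdom   *)
(* are meaningful.                                                          *)
Record chart (R : realType) (n : nat) (N : Type) := Chart {
  cdom : set N;
  cfun : N -> 'rV[R]_n;
  cinv : 'rV[R]_n -> N }.

Record is_chart (R : realType) (n : nat) (N : topologicalType)
    (c : chart R n N) : Prop := IsChart {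
  cdom_open : open (cdom c);
  cimg_open : open (cfun c @` cdom c);
  cfunK : forall p, cdom c p -> cinv c (cfun c p) = p;
  cfun_continuous : forall p, cdom c p -> {for p, continuous (cfun c)};
  cinv_continuous : forall x, (cfun c @` cdom c) x ->
    {for x, continuous (cinv c)} }.

(* A preferred chart chart_at p is fixed around each point p. The tangent   *)
(* space at p is 'rV_n, a row vector being the list of components in the    *)
(* coordinate basis of chart_at p.                                          *)
Record smooth_manifold (R : realType) (n : nat) := SmoothManifold {
  carrier :> topologicalType;
  carrier_hausdorff : hausdorff_space carrier;
  carrier_second_countable : @second_countable carrier;
  atlas : set (chart R n carrier);
  chart_at : carrier -> chart R n carrier;
  atlas_chart : forall c, atlas c -> is_chart c;
  chart_at_atlas : forall p, atlas (chart_at p);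
  chart_at_dom : forall p, cdom (chart_at p) p;
  atlas_compatible : forall c c', atlas c -> atlas c' ->
    smooth_on (cfun c @` (cdom c `&` cdom c')) (cfun c' \o cinv c) }.

Section Calculus.
Context {R : realType} {n : nat} {N : smooth_manifold R n}.
Local Notation T := 'rV[R]_n.
Implicit Types (p q : N) (U : set N) (f : N -> R) (v : T) (X Y : N -> T).

Definition pt_coord p : T := cfun (chart_at p) p.

(* Components in chart c of the tangent vector v at q. *)
Definition to_chart (c : chart R n N) q v : T :=
  'd (cfun c \o cinv (chart_at q)) (pt_coord q) v.

(* Tangent vector at q whose components in chart c are v. *)
Definition of_chart (c : chart R n N) q v : T :=
  'd (cfun (chart_at q) \o cinv c) (cfun c q) v.

Definition vf_in_chart (c : chart R n N) X : T -> T :=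
  fun x => to_chart c (cinv c x) (X (cinv c x)).

Definition smooth_fun U f : Prop := forall c, atlas c ->
  smooth_on (cfun c @` (U `&` cdom c)) (f \o cinv c).

Definition smooth_vf U X : Prop := forall c, atlas c ->
  smooth_on (cfun c @` (U `&` cdom c)) (vf_in_chart c X).

(* v(f) for a tangent vector v at p *)
Definition dirder p v f : R := 'D_v (f \o cinv (chart_at p)) (pt_coord p).

Definition lie_bracket X Y : N -> T := fun p =>
  'D_(X p) (vf_in_chart (chart_at p) Y) (pt_coord p)
  - 'D_(Y p) (vf_in_chart (chart_at p) X) (pt_coord p).

(* phi p is the column of coefficients of a covector at p. *)
Definition pairing (phi : N -> 'cV[R]_n) p v : R := (v *m phi p) 0 0.

Definition smooth_1form (phi : N -> 'cV[R]_n) : Prop :=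
  forall U X, open U -> smooth_vf U X ->
    smooth_fun U (fun p => pairing phi p (X p)).

(* g p is the Gram matrix of the metric at p. *)
Definition smooth_metric (g : N -> 'M[R]_n) : Prop :=
  forall U X Y, open U -> smooth_vf U X -> smooth_vf U Y ->
    smooth_fun U (fun p => inner (g p) (X p) (Y p)).

(* By Sylvester's law the last condition says that the index of the metric  *)
(* does not depend on the point.                                            *)
Record semi_riemannian (g : N -> 'M[R]_n) : Prop := SemiRiemannian {
  metric_smooth : smooth_metric g;
  metric_sym : forall p x y, inner (g p) x y = inner (g p) y x;
  metric_nondeg : forall p x, (forall y, inner (g p) x y = 0) -> x = 0;
  metric_index : exists k : nat, forall p, exists2 P : 'M[R]_n,
    P \in unitmx &
    P *m g p *m P^T = diag_mx (\row_(i < n) (if (i < k)%N then -1 else 1)) }.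

(* D p v Y is the covariant derivative at p, in the direction of the        *)
(* tangent vector v, of a vector field Y which is smooth near p.            *)
Record connection (D : N -> T -> (N -> T) -> T) : Prop := Connection {
  conn_local : forall U p v Y Y', open U -> U p -> smooth_vf U Y ->
    (forall q, U q -> Y q = Y' q) -> D p v Y = D p v Y';
  conn_linear : forall U p (a : R) (v w : T) Y, open U -> U p ->
    smooth_vf U Y ->
    D p (a *: v + w) Y = a *: D p v Y + D p w Y;
  conn_additive : forall U p v Y Z, open U -> U p ->
    smooth_vf U Y -> smooth_vf U Z ->
    D p v (fun q => Y q + Z q) = D p v Y + D p v Z;
  conn_leibniz : forall U p v f Y, open U -> U p ->
    smooth_fun U f -> smooth_vf U Y ->
    D p v (fun q => f q *: Y q) = dirder p v f *: Y p + f p *: D p v Y;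
  conn_smooth : forall U X Y, open U -> smooth_vf U X -> smooth_vf U Y ->
    smooth_vf U (fun p => D p (X p) Y) }.

Definition torsion_free (D : N -> T -> (N -> T) -> T) : Prop :=
  forall U X Y p, open U -> U p -> smooth_vf U X -> smooth_vf U Y ->
    D p (X p) Y - D p (Y p) X = lie_bracket X Y p.

(* The covariant derivative of g equals -2 phi (x) g. *)
Definition weyl_compatible (g : N -> 'M[R]_n)
    (D : N -> T -> (N -> T) -> T) (phi : N -> 'cV[R]_n) : Prop :=
  forall U X Y p v, open U -> U p -> smooth_vf U X -> smooth_vf U Y ->
    dirder p v (fun q => inner (g q) (X q) (Y q))
    - inner (g p) (D p v X) (Y p) - inner (g p) (X p) (D p v Y)
    = - 2 * pairing phi p v * inner (g p) (X p) (Y p).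

Definition curv_op (D : N -> T -> (N -> T) -> T) (X Y Z : N -> T) : N -> T :=
  fun p => D p (X p) (fun q => D q (Y q) Z) - D p (Y p) (fun q => D q (X q) Z)
           - D p (lie_bracket X Y p) Z.

(* Vector field with constant components in chart_at p and value v at p; it *)
(* is smooth on the domain of chart_at p.                                   *)
Definition extend p v : N -> T := fun q => of_chart (chart_at p) q v.

End Calculus.

Record weyl_manifold (R : realType) (n : nat) := WeylManifold {
  manifold :> smooth_manifold R n;
  metric : manifold -> 'M[R]_n;
  nabla : manifold -> 'rV[R]_n -> (manifold -> 'rV[R]_n) -> 'rV[R]_n;
  metric_semi_riemannian : semi_riemannian metric;
  nabla_connection : connection nabla;
  nabla_torsion_free : torsion_free nabla;
  nabla_weyl : exists2 phi : manifold -> 'cV[R]_n,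
    smooth_1form phi & weyl_compatible metric nabla phi }.

Section Weyl.
Context {R : realType} {n : nat}.
Variable W : weyl_manifold R n.

Local Notation field2 := (W -> form2 R n).
Local Notation field4 := (W -> form4 R n).

(* R(x,y,z,w) = g(R(x,y)z, w); the operator is tensorial, so that its value *)
(* at p may be computed with any vector fields extending x, y and z.        *)
Definition curvature : field4 := fun p x y z w =>
  inner (metric p) (curv_op (@nabla _ _ W) (extend p x) (extend p y)
                            (extend p z) p) w.

(* P is one of the pointwise formulas alpha_i, pi_i. *)
Definition component (P : 'M[R]_n -> form4 R n -> form4 R n) : field4 :=
  fun p => P (metric p) (curvature p).

Definition Ric (A : field4) : field2 := fun p => ricci (metric p) (A p).
Definition RicStar (A : field4) : field2 :=
  fun p => ricci_star (metric p) (A p).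

Definition Sym (t : field2) : field2 := fun p => sym (t p).
Definition Alt (t : field2) : field2 := fun p => alt (t p).

Definition einstein_weyl : Prop := exists lambda : W -> R,
  forall p, Sym (Ric curvature) p = lambda p *: inner (metric p).

End Weyl.

Arguments curvature {R n} W.
Arguments component {R n} W P.
Arguments einstein_weyl {R n} W.

(* Main.v *)
Require Import Defs.
From HB Require Import structures.
From mathcomp Require Import all_boot all_order all_algebra.
From mathcomp Require Import all_classical all_reals all_analysis.
From mathcomp Require Import ring.
Import Order.TTheory GRing.Theory Num.Theory numFieldNormedType.Exports.

Set Implicit Arguments.
Unset Strict Implicit.
Unset Printing Implicit Defensive.

Local Open Scope classical_set_scope.
Local Open Scope ring_scope.

(** Let E := S Ric - (tau / n) g be the trace-free part of the symmetrized
    Ricci tensor.  The manifold is Einstein-Weyl exactly when E = 0: if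
    S Ric = lambda g, taking the trace gives tau = n lambda.  Every other
    condition of the first list also says that E = 0, for these reasons:
    - alpha2, pi2 and pi5 are nonzero multiples of E wedge_r g for r = 1, 0 and
      n - 1 ([alpha2E], [pi2E], [pi5E]), so they vanish with E;
    - for a bilinear form t one has
        Ric (t wedge_r g) = (1 - n + r) t - r (tr t) g and
        Ric* (t wedge_r g) = (1 - r (n - 1)) t - (tr t) g
      ([ricci_wedge], [ricci_star_wedge]); since E has trace 0, the contractions
      of alpha2, pi2 and pi5 that occur in the statement are nonzero multiples
      of E, and each of them recovers E;
    - alpha1 = pi1 is a multiple of g wedge g, both contractions of which equal
      (tau / n) g = S Ric - E;
    - R - (alpha1 + alpha6 + alpha4 + alpha5) and R - (pi1 + pi3 + pi4 + pi6)
      are both alpha2, as alpha2 = pi2 + pi5 and alpha4 + alpha5 = pi3 + pi4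
      ([A_decomposition], [W_decomposition]).

    For the second list, S Ric - E = Ric forces Ric to be symmetric, because the
    left side is; then S Ric = Ric and E = 0.

    All this is linear algebra on one tangent space, but the contraction
    formulas need Ric to be bilinear, that is, the curvature R(x, y, z, w),
    computed with fields of constant components extending x, y and z, to be
    linear in y and z.  This follows from the axioms of a connection and the
    vanishing of the torsion, once these fields are known to be smooth
    ([smooth_extend]).  By the chain rule their components in another chart are
    directional derivatives of a transition map composed with its inverse, so
    what is needed is that smooth maps compose ([smooth_on_comp]). *)

(** * Smooth maps between normed spaces *)

Section ScaleDiff.
Context {R : realType} {V W : normedModType R}.

Lemma near_eq_differentiable (f g : V -> W) x :
  (\near x, f x = g x) -> differentiable f x -> differentiable g x.
Proof.
move=> fg df; have fgx : f x = g x by exact: nbhs_singleton fg.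
apply/diffP => /=.
apply: (@getPex _ (fun dg : {linear V -> W} => continuous dg /\
  forall y, g y = g (lim (nbhs x)) + dg (y - lim (nbhs x))
                  +o_(y \near x) (y - lim (nbhs x)))).
exists ('d f x); split; first exact: diff_continuous.
have /diffP[_ dfx] := df.
have /eqaddoP H : f = (fun y => f x + 'd f x (y - x)) +o_x (fun y => y - x).
  by apply/eqaddoE/funext => z /=; rewrite [LHS]dfx lim_id.
have K : g = (fun y => g x + 'd f x (y - x)) +o_x (fun y => y - x).
  apply/eqaddoP => e e0; apply: filterS2 fg (H e e0) => y fgy.
  by rewrite -[(g - _) y]/(g y - (g x + 'd f x (y - x))) -fgy -fgx.
by apply: eqaddoEx => y; rewrite lim_id // [LHS](congr1 (@^~ y) K).
Qed.

Lemma scale_is_bilinear :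
  bilinear_for
    (GRing.Scale.Law.clone _ _ *:%R _) (GRing.Scale.Law.clone _ _ *:%R _)
    (@GRing.scale R W).
Proof.
split=> [u'|u] a x y /=.
- by rewrite scalerDl scalerA.
- by rewrite scalerDr !scalerA mulrC.
Qed.
HB.instance Definition _ :=
  bilinear_isBilinear.Build R R W W _ _ (@GRing.scale R W) scale_is_bilinear.

Lemma scale_continuous2 : continuous (fun p : R * W => p.1 *: p.2).
Proof. move=> p; apply: (@cvgZ R W); [exact: cvg_fst|exact: cvg_snd]. Qed.

Lemma is_diff_scale (k dk : V -> R) (f df : V -> W) x :
  is_diff x k dk -> is_diff x f df ->
  is_diff x (fun y => k y *: f y) (fun y => k x *: df y + dk y *: f x).
Proof.
move=> dkx dfx.
have -> : (fun y => k y *: f y) = (fun p => p.1 *: p.2) \o (fun y => (k y, f y)).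
  by [].
have dp : is_diff (k x, f x) (fun p : R * W => p.1 *: p.2)
  (fun q => k x *: q.2 + q.1 *: f x).
  apply: DiffDef; first by apply: differentiable_bilin; exact: scale_continuous2.
  by rewrite diff_bilin //; exact: scale_continuous2.
exact: is_diff_eq.
Qed.
End ScaleDiff.

Section SmoothOn.
Context {R : realType}.
Implicit Types V W : normedModType R.

Lemma smooth_on_differentiable V W (U : set V) (f : V -> W) x :
  smooth_on U f -> U x -> differentiable f x.
Proof. by move=> sf Ux; exact: sf [::] x Ux. Qed.

Lemma smooth_on_derive V W (U : set V) (f : V -> W) v :
  smooth_on U f -> smooth_on U ('D_v f).
Proof. by move=> sf s x Ux; have := sf (rcons s v) x Ux; rewrite foldr_rcons. Qed.

(** To see that f is smooth it is enough to find a class of differentiable maps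
    that contains f and is closed under directional derivatives, up to equality
    on U; the iterated derivatives then never leave the class. *)
Lemma smooth_on_coind_eq V W (U : set V) (P : set (V -> W)) : open U ->
  (forall f x, P f -> U x -> differentiable f x) ->
  (forall f v, P f -> exists2 g, P g & forall x, U x -> 'D_v f x = g x) ->
  forall f g, P g -> (forall x, U x -> f x = g x) -> smooth_on U f.
Proof.
move=> oU Pdiff Pder f g Pg fg s.
have near_eq (h k : V -> W) x :
    (forall y, U y -> h y = k y) -> U x -> \near x, h x = k x.
  by move=> hk Ux; apply: filterS (open_nbhs_nbhs (conj oU Ux)) => y /hk.
elim/last_ind: s f g Pg fg => [|s v IHs] f g Pg fg x Ux.
  apply: near_eq_differentiable (Pdiff _ _ Pg Ux).
  by apply: near_eq => // y /fg.
have [g' Pg' gg'] := Pder g v Pg.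
rewrite foldr_rcons; apply: IHs Pg' _ x Ux => y Uy.
by rewrite (near_eq_derive _ (near_eq _ _ _ fg Uy)) gg'.
Qed.

Lemma smooth_on_coind V W (U : set V) (P : set (V -> W)) : open U ->
  (forall f x, P f -> U x -> differentiable f x) ->
  (forall f v, P f -> exists2 g, P g & forall x, U x -> 'D_v f x = g x) ->
  forall f, P f -> smooth_on U f.
Proof. by move=> oU Pdiff Pder f Pf; exact: (smooth_on_coind_eq oU Pdiff Pder Pf). Qed.

Lemma smooth_on_eq V W (U : set V) (f g : V -> W) : open U ->
  smooth_on U g -> (forall x, U x -> f x = g x) -> smooth_on U f.
Proof.
move=> oU; apply: (smooth_on_coind_eq (P := smooth_on U)) => // [{}f x|{}f v].
  exact: smooth_on_differentiable.
by exists ('D_v f) => //; exact: smooth_on_derive.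
Qed.

Lemma smooth_on_cst V W (U : set V) (c : W) :
  open U -> smooth_on U (cst c : V -> W).
Proof.
move=> oU.
apply: (smooth_on_coind (P := fun f => exists c, f = cst c)) => //.
- by move=> _ x [d ->] _; exact: differentiable_cst.
- move=> _ v [d ->]; exists (cst 0); first by exists 0.
  by move=> x _; rewrite derive_cst.
- by exists c.
Qed.

Lemma smooth_on_linear V W (U : set V) (a : R) (f g : V -> W) : open U ->
  smooth_on U f -> smooth_on U g -> smooth_on U (fun x => a *: f x + g x).
Proof.
move=> oU sf sg.
pose P h := exists f1 f2 : V -> W,
  [/\ smooth_on U f1, smooth_on U f2 & h = a *: f1 + f2].
apply: (smooth_on_coind (P := P)) => //.
- move=> _ x [f1 [f2 [s1 s2 ->]]] Ux; apply: differentiableD.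
    by apply: differentiableZ; exact: smooth_on_differentiable Ux.
  exact: smooth_on_differentiable Ux.
- move=> _ v [f1 [f2 [s1 s2 ->]]]; exists (a *: 'D_v f1 + 'D_v f2).
    by exists ('D_v f1), ('D_v f2); split => //; exact: smooth_on_derive.
  move=> x Ux.
  have d1 : derivable f1 x v by apply/diff_derivable/(smooth_on_differentiable _ Ux).
  have d2 : derivable f2 x v by apply/diff_derivable/(smooth_on_differentiable _ Ux).
  by rewrite deriveD ?deriveZ //; exact: derivableZ.
- by exists f, g.
Qed.

Lemma smooth_on_coord V m n (U : set V) (f : V -> 'M[R]_(m, n)) i j : open U ->
  smooth_on U f -> smooth_on U (fun x => f x i j : R).
Proof.
move=> oU sf.
pose coord (M : 'M[R]_(m, n)) : R := M i j.
have dcoord M : is_diff M coord coord.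
  apply: DiffDef; first exact: differentiable_coord.
  have lin : linear coord by move=> a A B; rewrite /coord !mxE.
  pose coordM := GRing.isLinear.Build _ _ _ _ _ lin.
  pose coordL : {linear _ -> _} := HB.pack coord coordM.
  by rewrite -[coord]/(coordL : _ -> _) diff_lin //; exact: coord_continuous.
pose P h := exists2 k, smooth_on U k & h = coord \o k.
apply: (smooth_on_coind (P := P)) => //; last by exists f.
- move=> _ x [k sk ->] Ux.
  by apply: differentiable_comp; first exact: smooth_on_differentiable Ux.
- move=> _ v [k sk ->]; exists (coord \o 'D_v k).
    by exists ('D_v k) => //; exact: smooth_on_derive.
  move=> x Ux; have dk := smooth_on_differentiable sk Ux.
  rewrite deriveE; last exact: differentiable_comp.
  by rewrite diff_comp //= deriveE // diff_val.
Qed.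

(** By the chain and Leibniz rules the iterated derivatives of h \o phi are sums
    of products of smooth scalars with maps k \o phi, where k is smooth; this is
    the least class containing such compositions that is closed under sums and
    multiplication by smooth scalars. *)
Inductive chain_closure V W m (U : set V) (O : set 'rV[R]_m)
    (phi : V -> 'rV[R]_m) : (V -> W) -> Prop :=
  | ChainComp h of smooth_on O h : chain_closure U O phi (h \o phi)
  | ChainAdd f g of chain_closure U O phi f & chain_closure U O phi g :
      chain_closure U O phi (f + g)
  | ChainScale (a : V -> R) f of smooth_on U a & chain_closure U O phi f :
      chain_closure U O phi (fun x => a x *: f x).

Lemma smooth_on_comp V W m (U : set V) (O : set 'rV[R]_m)
    (phi : V -> 'rV[R]_m) (h : 'rV[R]_m -> W) : open U -> open O ->
  (forall x, U x -> O (phi x)) -> smooth_on U phi -> smooth_on O h ->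
  smooth_on U (h \o phi).
Proof.
move=> oU oO UO sphi sh.
have Pdiff (f : V -> W) x : chain_closure U O phi f -> U x -> differentiable f x.
  move=> + Ux; elim => {f} [k sk|f g _ IHf _ IHg|a f sa _ IHf].
  - apply: differentiable_comp; first exact: smooth_on_differentiable Ux.
    exact: smooth_on_differentiable (UO _ Ux).
  - exact: differentiableD.
  - have da := smooth_on_differentiable sa Ux.
    exact: (@ex_diff _ _ _ _ _ _ _
      (is_diff_scale (differentiableP da) (differentiableP IHf))).
apply: (smooth_on_coind (P := chain_closure U O phi)) => //;
  last exact: ChainComp.
move=> f v; elim => {f} [k sk|f g Pf [f' Pf' ff'] Pg [g' Pg' gg']
  |a f sa Pf [f' Pf' ff']].
- exists (\sum_(j < m) fun x => ('D_v phi x) 0 j *: ('D_(delta_mx 0 j) k \o phi) x).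
    elim/big_ind: _ => [|//|j _].
    + by apply: (@ChainComp _ _ _ U O phi (cst 0)); exact: smooth_on_cst.
    + exact: ChainAdd.
    + apply: ChainScale.
        by apply: smooth_on_coord => //; exact: smooth_on_derive.
      by apply: ChainComp; exact: smooth_on_derive.
  move=> x Ux; have dphi := smooth_on_differentiable sphi Ux.
  have dk := smooth_on_differentiable sk (UO _ Ux).
  rewrite deriveE; last exact: differentiable_comp.
  rewrite diff_comp //=.
  have -> : 'd phi x v = 'D_v phi x by rewrite deriveE.
  (* The chain rule in coordinates: the derivative of phi is expanded in the
     standard basis so that only derivatives of k in fixed directions occur. *)
  rewrite [X in 'd k _ X]row_sum_delta linear_sum fct_sumE; apply: eq_bigr => j _.
  by rewrite linearZ /= -deriveE.
- exists (f' + g'); first exact: ChainAdd.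
  move=> x Ux; rewrite deriveD ?ff' ?gg' //; exact/diff_derivable/Pdiff.
- exists ((fun x => a x *: f' x) + (fun x => 'D_v a x *: f x)).
    apply: ChainAdd; apply: ChainScale => //; exact: smooth_on_derive.
  move=> x Ux; have da := smooth_on_differentiable sa Ux.
  have df := Pdiff _ _ Pf Ux.
  have D := is_diff_scale (differentiableP da) (differentiableP df).
  rewrite deriveE; last exact: ex_diff.
  by rewrite diff_val -[RHS]/(a x *: f' x + 'D_v a x *: f x) -ff' // !deriveE.
Qed.
End SmoothOn.

Lemma diff_comp_derive (R : realType) (U V W : normedModType R) (f : U -> V)
    (g : V -> W) x v : differentiable f x -> differentiable g (f x) ->
  'd g (f x) ('d f x v) = 'D_v (g \o f) x.
Proof.
move=> df dg; have dgf : differentiable (g \o f) x by apply: differentiable_comp.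
by rewrite deriveE // (diff_comp df dg).
Qed.

Lemma scaleB_add (R : pzRingType) (V : lmodType R) (a : R) (u v x y : V) :
  a *: u + x - (a *: v + y) = a *: (u - v) + (x - y).
Proof. by rewrite opprD addrACA -scalerBr. Qed.

(** * Fields of constant components are smooth *)

Section Charts.
Context {R : realType} {n : nat} {N : smooth_manifold R n}.
Implicit Types (U : set N) (X Y Z : N -> 'rV[R]_n).

Lemma chart_image_open (c : chart R n N) U :
  atlas c -> open U -> open (cfun c @` (U `&` cdom c)).
Proof.
move=> /atlas_chart ic oU; rewrite openE => _ [q [Uq cq] <-].
have imgq : (cfun c @` cdom c) (cfun c q) by exists q.
have near_img : nbhs (cfun c q) (cfun c @` cdom c).
  by apply: open_nbhs_nbhs; split => //; exact: cimg_open ic.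
have near_U : nbhs (cfun c q) (cinv c @^-1` U).
  apply: (cinv_continuous ic imgq); rewrite (cfunK ic) //.
  exact: open_nbhs_nbhs.
apply: filterS2 near_img near_U => _ [q' cq' <-].
by rewrite /preimage /= (cfunK ic) // => Uq'; exists q'.
Qed.

(** The chart preferred at q drops out, by the chain rule for the two transition
    maps through it. *)
Lemma to_of_chart (c c0 : chart R n N) q v : atlas c -> atlas c0 ->
  cdom c q -> cdom c0 q ->
  to_chart c q (of_chart c0 q v) = 'd (cfun c \o cinv c0) (cfun c0 q) v.
Proof.
move=> Ac Ac0 cq c0q; set s := chart_at q.
have As : atlas s := chart_at_atlas q.
have sq : cdom s q := chart_at_dom q.
have c0K := cfunK (atlas_chart Ac0); have sK := cfunK (atlas_chart As).
have dtrans (a b : chart R n N) : atlas a -> atlas b -> cdom a q -> cdom b q ->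
    differentiable (cfun b \o cinv a) (cfun a q).
  move=> Aa Ab aq bq; apply: smooth_on_differentiable (atlas_compatible Aa Ab) _.
  by exists q.
have sphi : (cfun s \o cinv c0) (cfun c0 q) = cfun s q by rewrite /= c0K.
have dcs : differentiable (cfun c \o cinv s) ((cfun s \o cinv c0) (cfun c0 q)).
  by rewrite sphi; exact: dtrans.
have dsc0 := dtrans _ _ Ac0 As c0q sq.
rewrite /to_chart /of_chart -/s /pt_coord -/s -[in LHS]sphi.
apply: (etrans (diff_comp_derive v dsc0 dcs)).
apply: etrans (deriveE v (dtrans _ _ Ac0 Ac c0q cq)).
apply: near_eq_derive.
have oI : open (cfun c0 @` (cdom s `&` cdom c0)).
  by apply: chart_image_open => //; exact: cdom_open (atlas_chart As).
have : nbhs (cfun c0 q) (cfun c0 @` (cdom s `&` cdom c0)).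
  by apply: open_nbhs_nbhs; split => //; exists q.
by apply: filterS => _ [q' [sq' c0q'] <-] /=; rewrite c0K // sK.
Qed.

(** In the chart c the field is a directional derivative of the transition map
    from the chart at p to c, precomposed with the inverse transition map. *)
Lemma smooth_extend (p : N) v : smooth_vf (cdom (chart_at p)) (extend p v).
Proof.
move=> c Ac; set c0 := chart_at p.
have Ac0 : atlas c0 := chart_at_atlas p.
have cK := cfunK (atlas_chart Ac); have c0K := cfunK (atlas_chart Ac0).
have oc := cdom_open (atlas_chart Ac); have oc0 := cdom_open (atlas_chart Ac0).
have oU := chart_image_open Ac oc0.
have oO := chart_image_open Ac0 oc.
apply: (@smooth_on_eq _ _ _ _ _
  ('D_v (cfun c \o cinv c0) \o (cfun c0 \o cinv c))) => //.
- apply: (smooth_on_comp (O := cfun c0 @` (cdom c `&` cdom c0))) => //.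
  + by move=> _ [q [c0q cq] <-] /=; rewrite cK //; exists q.
  + by rewrite setIC; exact: atlas_compatible.
  + by rewrite setIC; apply: smooth_on_derive; exact: atlas_compatible.
- move=> _ [q [c0q cq] <-] /=.
  rewrite /vf_in_chart cK // to_of_chart // deriveE //.
  apply: smooth_on_differentiable (atlas_compatible Ac0 Ac) _.
  by exists q.
Qed.

Lemma smooth_vf_linear U a X Y : open U -> smooth_vf U X -> smooth_vf U Y ->
  smooth_vf U (fun q => a *: X q + Y q).
Proof.
move=> oU sX sY c Ac.
have -> : vf_in_chart c (fun q => a *: X q + Y q) =
    (fun x => a *: vf_in_chart c X x + vf_in_chart c Y x).
  by apply/funext => x; rewrite /vf_in_chart /to_chart linearP.
by apply: smooth_on_linear; [exact: chart_image_open | exact: sX | exact: sY].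
Qed.

Lemma smooth_fun_cst U (a : R) : open U -> smooth_fun U (cst a).
Proof. by move=> oU c Ac; apply: smooth_on_cst; exact: chart_image_open. Qed.

Lemma extend_linear (p : N) a v w :
  extend p (a *: v + w) = fun q => a *: extend p v q + extend p w q.
Proof. by apply/funext => q; rewrite /extend /of_chart linearP. Qed.

(** * Linearity of the curvature in its second and third arguments *)

Section Connections.
Variable D : N -> 'rV[R]_n -> (N -> 'rV[R]_n) -> 'rV[R]_n.
Hypotheses (connD : connection D) (tfD : torsion_free D).
Variables (U : set N) (oU : open U).

Lemma conn_vf_linear p v a Y Z : U p -> smooth_vf U Y -> smooth_vf U Z ->
  D p v (fun q => a *: Y q + Z q) = a *: D p v Y + D p v Z.
Proof.
move=> Up sY sZ.
have saY : smooth_vf U (fun q => a *: Y q).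
  (* The summand Y makes the zero field superfluous:
     a *: Y = (a - 1) *: Y + Y. *)
  have := smooth_vf_linear (a - 1) oU sY sY; congr smooth_vf.
  by apply/funext => q; rewrite scalerBl scale1r subrK.
rewrite (conn_additive connD _ oU Up saY sZ); congr (_ + _).
rewrite (conn_leibniz connD v oU Up (smooth_fun_cst a oU) sY).
by rewrite /dirder derive_cst scale0r add0r.
Qed.

(** Linearity over constants is enough, so no derivative of a coefficient enters.
    The bracket is linear because torsion-freeness makes it a difference of two
    covariant derivatives. *)
Lemma curv_op_linear2 p a X Y1 Y2 Z :
  U p -> smooth_vf U X -> smooth_vf U Y1 -> smooth_vf U Y2 -> smooth_vf U Z ->
  curv_op D X (fun q => a *: Y1 q + Y2 q) Z p
  = a *: curv_op D X Y1 Z p + curv_op D X Y2 Z p.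
Proof.
move=> Up sX s1 s2 sZ; have s12 := smooth_vf_linear a oU s1 s2.
have sD1 := conn_smooth connD oU s1 sZ; have sD2 := conn_smooth connD oU s2 sZ.
have bracket : lie_bracket X (fun q => a *: Y1 q + Y2 q) p
    = a *: lie_bracket X Y1 p + lie_bracket X Y2 p.
  rewrite -!(tfD oU Up) // conn_vf_linear // (conn_linear connD _ _ _ oU Up) //.
  by rewrite scaleB_add.
rewrite /curv_op bracket !(conn_linear connD _ _ _ oU Up) //; last first.
  exact: (conn_smooth connD oU sX sZ).
rewrite -(conn_local connD (X p) oU Up (smooth_vf_linear a oU sD1 sD2));
  last first.
  by move=> q Uq; rewrite (conn_linear connD _ _ _ oU Uq).
by rewrite conn_vf_linear // !scaleB_add.
Qed.

Lemma curv_op_linear3 p a X Y Z1 Z2 :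
  U p -> smooth_vf U X -> smooth_vf U Y -> smooth_vf U Z1 -> smooth_vf U Z2 ->
  curv_op D X Y (fun q => a *: Z1 q + Z2 q) p
  = a *: curv_op D X Y Z1 p + curv_op D X Y Z2 p.
Proof.
move=> Up sX sY s1 s2.
have inner_conn V (q : N) : U q ->
    a *: D q (V q) Z1 + D q (V q) Z2 = D q (V q) (fun q => a *: Z1 q + Z2 q).
  by move=> Uq; rewrite conn_vf_linear.
have sD V : smooth_vf U V ->
  smooth_vf U (fun q => D q (V q) Z1) /\ smooth_vf U (fun q => D q (V q) Z2).
  by move=> sV; split; exact: (conn_smooth connD oU).
have [sX1 sX2] := sD X sX; have [sY1 sY2] := sD Y sY.
rewrite /curv_op.
rewrite -(conn_local connD _ oU Up (smooth_vf_linear a oU sX1 sX2)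
  (inner_conn X)).
rewrite -(conn_local connD _ oU Up (smooth_vf_linear a oU sY1 sY2)
  (inner_conn Y)).
by rewrite !conn_vf_linear // !scaleB_add.
Qed.
End Connections.
End Charts.

Section Curvature.
Context {R : realType} {n : nat}.
Variable W : weyl_manifold R n.

Lemma inner_linearl (g : 'M[R]_n) a x y z :
  inner g (a *: x + y) z = a * inner g x z + inner g y z.
Proof. by rewrite /inner !mulmxDl -!scalemxAl !mxE. Qed.

Lemma curvature_scalar2 (p : W) x z w : scalar (fun y => curvature W p x y z w).
Proof.
move=> a y y'.
have oU := cdom_open (atlas_chart (chart_at_atlas p)).
rewrite /curvature extend_linear.
rewrite (curv_op_linear2 (@nabla_connection _ _ W) (@nabla_torsion_free _ _ W)
  oU) //;
  do ?exact: smooth_extend; last exact: chart_at_dom.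
exact: inner_linearl.
Qed.

Lemma curvature_scalar3 (p : W) x y w : scalar (fun z => curvature W p x y z w).
Proof.
move=> a z z'.
have oU := cdom_open (atlas_chart (chart_at_atlas p)).
rewrite /curvature extend_linear.
rewrite (curv_op_linear3 (@nabla_connection _ _ W) oU) //;
  do ?exact: smooth_extend; last exact: chart_at_dom.
exact: inner_linearl.
Qed.
End Curvature.

(** * Contractions on one tangent space *)

Section Contractions.
Context {R : realType} {n : nat}.
Variable g : 'M[R]_n.
Local Notation V := 'rV[R]_n.
Local Notation G := (inner g).
Implicit Types (t : V -> V -> R) (f : V -> R) (x y : V).

Lemma scalar_basis f x : scalar f -> f x = \sum_(i < n) x 0 i * f (Defs.basis i).
Proof.
move=> flin; pose fM := GRing.isLinear.Build _ _ _ _ _ flin.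
pose fL : {scalar V} := HB.pack f fM.
rewrite -[f]/(fL : _ -> _) [in LHS](row_sum_delta x) linear_sum.
by apply: eq_bigr => i _; rewrite linearZ.
Qed.

Lemma inner_basisr x j : G x (Defs.basis j) = (x *m g) 0 j.
Proof. by rewrite /inner /Defs.basis trmx_delta -colE mxE. Qed.

Lemma eq_trace t1 t2 : (forall a b, t1 a b = t2 a b) -> trace g t1 = trace g t2.
Proof. by move=> t12; do 2![apply: eq_bigr => ? _]; rewrite t12. Qed.

Lemma traceD t1 t2 :
  trace g (fun a b => t1 a b + t2 a b) = trace g t1 + trace g t2.
Proof.
rewrite /trace -big_split; apply: eq_bigr => i _; rewrite -big_split.
by apply: eq_bigr => j _; rewrite mulrDr.
Qed.

Lemma traceZ c t : trace g (fun a b => c * t a b) = c * trace g t.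
Proof.
rewrite /trace mulr_sumr; apply: eq_bigr => i _; rewrite mulr_sumr.
by apply: eq_bigr => j _; rewrite mulrCA.
Qed.

Hypotheses (gsym : g^T = g) (gunit : g \in unitmx).

Lemma invmx_sym i j : invmx g i j = invmx g j i.
Proof. by rewrite -[in LHS]gsym -trmx_inv mxE. Qed.

Lemma innerC x y : G x y = G y x.
Proof.
transitivity ((x *m g *m y^T)^T 0 0); first by rewrite mxE.
by rewrite !trmx_mul trmxK gsym mulmxA.
Qed.

Lemma traceC t : trace g (fun a b => t b a) = trace g t.
Proof.
rewrite /trace exchange_big; do 2![apply: eq_bigr => ? _].
by rewrite invmx_sym.
Qed.

(** Raising an index and lowering it again is the identity. *)
Lemma trace_contractr f x :
  scalar f -> trace g (fun a b => f a * G x b) = f x.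
Proof.
move=> flin; rewrite (scalar_basis x flin); apply: eq_bigr => i _.
transitivity (f (Defs.basis i) * \sum_(j < n) (x *m g) 0 j * invmx g j i).
  rewrite mulr_sumr; apply: eq_bigr => j _.
  by rewrite inner_basisr invmx_sym; ring.
have -> : \sum_(j < n) (x *m g) 0 j * invmx g j i = (x *m g *m invmx g) 0 i.
  by rewrite mxE.
by rewrite mulmxK // mulrC.
Qed.

Lemma trace_contractl f x :
  scalar f -> trace g (fun a b => G a x * f b) = f x.
Proof.
move=> flin; rewrite -(trace_contractr x flin) -traceC.
by apply: eq_trace => a b; rewrite mulrC innerC.
Qed.

Lemma trace_inner : trace g G = n%:R.
Proof.
transitivity (\sum_(i < n) (g *m invmx g) i i).
  apply: eq_bigr => i _; rewrite mxE; apply: eq_bigr => j _.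
  rewrite innerC inner_basisr -rowE mxE mulrC.
  by rewrite -[in g i j]gsym mxE invmx_sym mulrC.
by rewrite mulmxV // -/(mxtrace _) mxtrace1.
Qed.

Lemma ricci_wedge r t x y :
  (forall z, scalar (t^~ z)) -> (forall z, scalar (t z)) ->
  ricci g (wedge r t G) x y = (1 - n%:R + r%:~R) * t x y
    - r%:~R * trace g t * G x y.
Proof.
move=> tl tr; rewrite /ricci.
rewrite (@eq_trace _ (fun a b => t a y * G x b + - t x y * G a b
  + (- r%:~R * G x y) * t a b + r%:~R * (G a y * t x b))); last first.
  by move=> a b; rewrite /wedge; ring.
rewrite !traceD !traceZ trace_contractr // trace_contractl // trace_inner.
by ring.
Qed.

Lemma ricci_star_wedge r t x y :
  (forall z, scalar (t^~ z)) -> (forall z, scalar (t z)) ->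
  ricci_star g (wedge r t G) x y
  = (1 - r%:~R * (n%:R - 1)) * t x y - trace g t * G x y.
Proof.
move=> tl tr; rewrite /ricci_star.
rewrite (@eq_trace _ (fun a b => G a y * t x b + - G x y * t a b
  + (- r%:~R * t x y) * G a b + r%:~R * (t a y * G x b))); last first.
  by move=> a b; rewrite /wedge; ring.
rewrite !traceD !traceZ trace_contractr // trace_contractl // trace_inner.
by ring.
Qed.

End Contractions.

Lemma wedge0l (R : realType) (n : nat) r (t : 'rV[R]_n -> 'rV[R]_n -> R) :
  wedge r 0 t = 0.
Proof.
apply/funext => x; apply/funext => y; apply/funext => z; apply/funext => w.
transitivity (0 * t y w - 0 * t x w - r%:~R * (0 * t y z - 0 * t x z)) => //.
by rewrite !mul0r subrr mulr0 subrr.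
Qed.

(** * The components in terms of the trace-free Ricci tensor *)

Section TraceFreeRicci.
Context {R : realType} {n : nat}.
Variables (g : 'M[R]_n) (A : 'rV[R]_n -> 'rV[R]_n -> 'rV[R]_n -> 'rV[R]_n -> R).
Local Notation V := 'rV[R]_n.
Local Notation G := (inner g).
Local Notation m := (n%:R : R).
Local Notation tau := (trace g (ricci g A)).

Definition tracefree_ricci : V -> V -> R :=
  fun x y => sym (ricci g A) x y - tau / m * G x y.
Local Notation E := tracefree_ricci.

Hypothesis n_ge3 : (3 <= n)%N.

Lemma dim_neq0 : [/\ m != 0, m - 1 != 0, m - 2 != 0 & m + 1 != 0].
Proof.
have n_neq k : (k < 3)%N -> (n%:R : R) - k%:R != 0.
  by move=> k3; rewrite subr_eq0 eqr_nat gtn_eqF // (leq_trans k3).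
by split; [have := n_neq 0 isT; rewrite subr0 | exact: (n_neq 1 isT) |
  exact: (n_neq 2 isT) | rewrite natr1 pnatr_eq0].
Qed.

Lemma alpha2E : alpha2 g A = - (m - 2)^-1 *: wedge 1 E G.
Proof.
have [m0 m1 m2 _] := dim_neq0; apply/funext => x; apply/funext => y.
apply/funext => z; apply/funext => w.
transitivity (- (m - 2)^-1 * wedge 1 (sym (ricci g A)) G x y z w
  + (2 / (m * (m - 2)) * tau) * wedge 0 G G x y z w) => //.
transitivity (- (m - 2)^-1 * wedge 1 E G x y z w) => //.
by rewrite /wedge /E; field; rewrite ?m0.
Qed.

Lemma pi2E : pi2 g A = - (m - 1)^-1 *: wedge 0 E G.
Proof.
have [m0 m1 m2 _] := dim_neq0; apply/funext => x; apply/funext => y.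
apply/funext => z; apply/funext => w.
transitivity ((m - 1)^-1 *
  wedge 0 (fun a b => tau / m * G a b - sym (ricci g A) a b) G x y z w) => //.
transitivity (- (m - 1)^-1 * wedge 0 E G x y z w) => //.
by rewrite /wedge /E; field; rewrite ?m0.
Qed.

Lemma dim_intr : (n%:Z - 1)%:~R = m - 1.
Proof. by rewrite rmorphB. Qed.

Lemma pi5E : pi5 g A = - ((m - 1) * (m - 2))^-1 *: wedge (n%:Z - 1) E G.
Proof.
have [m0 m1 m2 _] := dim_neq0; apply/funext => x; apply/funext => y.
apply/funext => z; apply/funext => w.
transitivity (((m - 1) * (m - 2))^-1 *
  (tau * wedge 0 G G x y z w - wedge (n%:Z - 1) (sym (ricci g A)) G x y z w)) => //.
transitivity (- ((m - 1) * (m - 2))^-1 * wedge (n%:Z - 1) E G x y z w) => //.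
by rewrite /wedge /E dim_intr; field; rewrite m0 m2.
Qed.

(** The Lambda Ric terms cancel since wedge_(-1) + wedge_3 = 2 wedge_1, and the
    coefficients of tau g wedge g add up to 0. *)
Lemma A_decomposition :
  A = alpha1 g A + alpha6 g A + alpha4 g A + alpha5 g A + alpha2 g A.
Proof.
have [m0 m1 m2 _] := dim_neq0; apply/funext => x; apply/funext => y.
apply/funext => z; apply/funext => w.
transitivity (- (tau / (m * (m - 1))) * wedge 0 G G x y z w
  + (A x y z w + (2 / m) * tens (alt (ricci g A)) G x y z w
     + m^-1 * wedge 1 (alt (ricci g A)) G x y z w
     + (m - 2)^-1 * wedge 1 (sym (ricci g A)) G x y z w
     - (tau / ((m - 1) * (m - 2))) * wedge 0 G G x y z w)
  + - (2 * m)^-1 * (2 * tens (alt (ricci g A)) G x y z w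
     + wedge (-1) (alt (ricci g A)) G x y z w)
  + - (2 * m)^-1 * (2 * tens (alt (ricci g A)) G x y z w
     + wedge 3 (alt (ricci g A)) G x y z w)
  + (- (m - 2)^-1 * wedge 1 (sym (ricci g A)) G x y z w
     + (2 / (m * (m - 2)) * tau) * wedge 0 G G x y z w)) => //.
rewrite /wedge /tens; field.
by rewrite m0 m1 m2.
Qed.

(** The sum closes with alpha2, which is pi2 + pi5. *)
Lemma W_decomposition :
  A = pi1 g A + pi3 g A + pi4 g A + pi6 g A + alpha2 g A.
Proof.
have [m0 m1 m2 m3] := dim_neq0.
apply/funext => x; apply/funext => y; apply/funext => z; apply/funext => w.
transitivity (- (tau / (m * (m - 1))) * wedge 0 G G x y z w
  + - (m + 1)^-1 * (2 * tens (alt (ricci g A)) G x y z w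
     + wedge 0 (alt (ricci g A)) G x y z w)
  + - (m * (m + 1))^-1 * (2 * tens (alt (ricci g A)) G x y z w
     + wedge (n%:Z + 1) (alt (ricci g A)) G x y z w)
  + (A x y z w + (2 / m) * tens (alt (ricci g A)) G x y z w
     + m^-1 * wedge 1 (alt (ricci g A)) G x y z w
     + (m - 2)^-1 * wedge 1 (sym (ricci g A)) G x y z w
     - (tau / ((m - 1) * (m - 2))) * wedge 0 G G x y z w)
  + (- (m - 2)^-1 * wedge 1 (sym (ricci g A)) G x y z w
     + (2 / (m * (m - 2)) * tau) * wedge 0 G G x y z w)) => //.
(* wedge_r is affine in r, so wedge_(n+1) interpolates wedge_0 and wedge_1. *)
have -> : wedge (n%:Z + 1) (alt (ricci g A)) G x y z w
    = wedge 0 (alt (ricci g A)) G x y z w - (m + 1) *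
      (wedge 0 (alt (ricci g A)) G x y z w - wedge 1 (alt (ricci g A)) G x y z w).
  by rewrite /wedge rmorphD /=; ring.
rewrite /wedge /tens; field.
by rewrite m0 m1 m2 m3.
Qed.

Hypotheses (gsym : g^T = g) (gunit : g \in unitmx).
Hypotheses (A_linear2 : forall x z w, scalar (fun y => A x y z w))
  (A_linear3 : forall x y w, scalar (fun z => A x y z w)).

Lemma inner_scalarl z : scalar (G^~ z).
Proof. by move=> a x y; rewrite inner_linearl. Qed.

Lemma inner_scalarr z : scalar (G z).
Proof. by move=> a x y; rewrite ![G z _]innerC // inner_scalarl. Qed.

Lemma ricci_scalarl y : scalar ((ricci g A)^~ y).
Proof.
move=> a x x'; rewrite /ricci -traceZ -traceD.
by apply: eq_trace => i j; rewrite A_linear2.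
Qed.

Lemma ricci_scalarr x : scalar (ricci g A x).
Proof.
move=> a y y'; rewrite /ricci -traceZ -traceD.
by apply: eq_trace => i j; rewrite A_linear3.
Qed.

Lemma tracefree_ricciC x y : E x y = E y x.
Proof. by rewrite /E /sym (innerC gsym) [_ + ricci g A y x]addrC. Qed.

Lemma tracefree_ricci_scalarl y : scalar (E^~ y).
Proof.
move=> a x x'.
by rewrite /E /sym ricci_scalarl ricci_scalarr inner_scalarl; ring.
Qed.

Lemma tracefree_ricci_scalarr x : scalar (E x).
Proof.
by move=> a y y'; rewrite ![E x _]tracefree_ricciC tracefree_ricci_scalarl.
Qed.

Lemma trace_sym t : trace g (sym t) = trace g t.
Proof.
rewrite (@eq_trace _ _ _ _ (fun a b => 2^-1 * t a b + 2^-1 * t b a)); last first.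
  by move=> a b; rewrite /sym mulrC mulrDr.
by rewrite traceD !traceZ traceC // -mulrDl -[2^-1]mul1r -splitr mul1r.
Qed.

Lemma trace_tracefree_ricci : trace g E = 0.
Proof.
have [m0 _ _ _] := dim_neq0.
rewrite (@eq_trace _ _ _ _
  (fun a b => sym (ricci g A) a b + - (tau / m) * G a b)); last first.
  by move=> a b; rewrite mulNr.
by rewrite traceD traceZ trace_sym trace_inner // mulNr divfK // subrr.
Qed.

Lemma ricci_wedge_tracefree r :
  ricci g (wedge r E G) = (1 - m + r%:~R) *: E.
Proof.
apply/funext => x; apply/funext => y.
rewrite ricci_wedge //;
  [|exact: tracefree_ricci_scalarl|exact: tracefree_ricci_scalarr].
by rewrite trace_tracefree_ricci mulr0 mul0r subr0.
Qed.

Lemma ricci_star_wedge_tracefree r :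
  ricci_star g (wedge r E G) = (1 - r%:~R * (m - 1)) *: E.
Proof.
apply/funext => x; apply/funext => y.
rewrite ricci_star_wedge //;
  [|exact: tracefree_ricci_scalarl|exact: tracefree_ricci_scalarr].
by rewrite trace_tracefree_ricci mul0r subr0.
Qed.

Lemma ricciZ c B : ricci g (c *: B) = c *: ricci g B.
Proof. by apply/funext => x; apply/funext => y; exact: traceZ. Qed.

Lemma ricci_starZ c B : ricci_star g (c *: B) = c *: ricci_star g B.
Proof. by apply/funext => x; apply/funext => y; exact: traceZ. Qed.

Lemma ricci_alpha2 : ricci g (alpha2 g A) = E.
Proof.
have [_ _ m2 _] := dim_neq0.
rewrite alpha2E ricciZ ricci_wedge_tracefree scalerA.
by rewrite [X in X *: _](_ : _ = 1) ?scale1r //; field.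
Qed.

Lemma ricci_star_alpha2 : ricci_star g (alpha2 g A) = E.
Proof.
have [_ _ m2 _] := dim_neq0.
rewrite alpha2E ricci_starZ ricci_star_wedge_tracefree scalerA.
by rewrite [X in X *: _](_ : _ = 1) ?scale1r //; field.
Qed.

Lemma ricci_pi2 : ricci g (pi2 g A) = E.
Proof.
have [_ m1 _ _] := dim_neq0.
rewrite pi2E ricciZ ricci_wedge_tracefree scalerA.
by rewrite [X in X *: _](_ : _ = 1) ?scale1r //; field.
Qed.

Lemma ricci_star_pi2 : ricci_star g (pi2 g A) = - (m - 1)^-1 *: E.
Proof.
have [_ m1 _ _] := dim_neq0.
rewrite pi2E ricci_starZ ricci_star_wedge_tracefree scalerA.
by congr (_ *: _); rewrite mul0r subr0 mulr1.
Qed.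

Lemma ricci_star_pi5 : ricci_star g (pi5 g A) = (m / (m - 1)) *: E.
Proof.
have [_ m1 m2 _] := dim_neq0.
rewrite pi5E ricci_starZ ricci_star_wedge_tracefree scalerA.
by congr (_ *: _); rewrite dim_intr; field; rewrite m1.
Qed.

Lemma ricci_alpha1 : ricci g (alpha1 g A) = sym (ricci g A) - E.
Proof.
have [m0 m1 _ _] := dim_neq0; rewrite /alpha1 ricciZ.
apply/funext => x; apply/funext => y.
transitivity (- (tau / (m * (m - 1))) * ricci g (wedge 0 G G) x y) => //.
transitivity (sym (ricci g A) x y - E x y) => //.
rewrite ricci_wedge //; [|exact: inner_scalarl|exact: inner_scalarr].
by rewrite /E; field; rewrite m0.
Qed.

Lemma ricci_star_alpha1 : ricci_star g (alpha1 g A) = sym (ricci g A) - E.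
Proof.
have [m0 m1 _ _] := dim_neq0; rewrite /alpha1 ricci_starZ.
apply/funext => x; apply/funext => y.
transitivity (- (tau / (m * (m - 1))) * ricci_star g (wedge 0 G G) x y) => //.
transitivity (sym (ricci g A) x y - E x y) => //.
rewrite ricci_star_wedge //; [|exact: inner_scalarl|exact: inner_scalarr].
by rewrite trace_inner // /E; field; rewrite m0.
Qed.

Lemma tracefree_ricci_eq0 :
  E = 0 <-> exists lambda : R, sym (ricci g A) = lambda *: G.
Proof.
have [m0 _ _ _] := dim_neq0; split=> [E0|[lambda SG]].
  exists (tau / m); apply/funext => x; apply/funext => y.
  by apply/subr0_eq; rewrite -[LHS]/(E x y) E0.
have tauE : tau = lambda * m.
  by rewrite -trace_sym SG -(trace_inner gsym gunit) -traceZ.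
apply/funext => x; apply/funext => y.
by rewrite /E SG tauE mulfK // subrr.
Qed.

Lemma sym_add_alt (t : V -> V -> R) : t = sym t + alt t.
Proof.
apply/funext => x; apply/funext => y.
by transitivity (sym t x y + alt t x y) => //; rewrite /sym /alt; field.
Qed.

(** The left side of the second equation is symmetric, so the equation forces
    Ric to be symmetric. *)
Lemma tracefree_and_alt_eq0 :
  E = 0 /\ alt (ricci g A) = 0 <-> sym (ricci g A) - E = ricci g A.
Proof.
split=> [[-> altR0]|RicE].
  by rewrite subr0 [RHS]sym_add_alt altR0 addr0.
have RicC x y : ricci g A x y = ricci g A y x.
  transitivity (sym (ricci g A) x y - E x y); first by rewrite -[in LHS]RicE.
  rewrite tracefree_ricciC /sym addrC [_ + ricci g A y x]addrC addrC.
  by rewrite -[in RHS]RicE.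
have altR0 : alt (ricci g A) = 0.
  by apply/funext => x; apply/funext => y; rewrite /alt RicC subrr mul0r.
have symR : sym (ricci g A) = ricci g A.
  by rewrite [RHS]sym_add_alt altR0 addr0.
by split => //; rewrite -[LHS](subKr (sym (ricci g A))) RicE symR subrr.
Qed.

End TraceFreeRicci.

(** * The conditions on a Weyl manifold *)

Section WeylTensor.
Context {R : realType} {n : nat}.
Variables (W : weyl_manifold R n).
Hypothesis n_ge3 : (3 <= n)%N.
Local Notation Rm := (curvature W).

Lemma metric_trmx (p : W) : (metric p)^T = metric p.
Proof.
have entry i j : metric p i j = inner (metric p) (Defs.basis i) (Defs.basis j).
  by rewrite inner_basisr /Defs.basis -rowE mxE.
apply/matrixP => i j; rewrite mxE !entry.
exact: (Defs.metric_sym (metric_semi_riemannian W)).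
Qed.

Lemma metric_unitmx (p : W) : metric p \in unitmx.
Proof.
rewrite -row_free_unit; apply: inj_row_free => x xg0.
apply: (@metric_nondeg _ _ _ _ (metric_semi_riemannian W) p) => y.
by rewrite /inner xg0 mul0mx mxE.
Qed.

Definition tracefree_Ric : W -> 'rV[R]_n -> 'rV[R]_n -> R :=
  fun p => tracefree_ricci (metric p) (Rm p).
Local Notation E := tracefree_Ric.

Lemma einstein_weylE : einstein_weyl W <-> E = 0.
Proof.
have eq0 p := tracefree_ricci_eq0 (Rm p) n_ge3 (metric_trmx p) (metric_unitmx p).
split=> [[lambda SG]|E0].
  apply/funext => p; apply/(eq0 p); exists (lambda p); exact: SG.
have [lambda SG] : {lambda : W -> R &
    forall p, Sym (Ric Rm) p = lambda p *: inner (metric p)}.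
  apply: (boolp.choice
    (P := fun p l => Sym (Ric Rm) p = l *: inner (metric p))) => p.
  by apply/(eq0 p); rewrite -[LHS]/(E p) E0.
by exists lambda.
Qed.

Lemma Ric_alpha2 : Ric (component W alpha2) = E.
Proof.
apply/funext => p.
exact: (ricci_alpha2 n_ge3 (metric_trmx p) (metric_unitmx p)
  (curvature_scalar2 p) (curvature_scalar3 p)).
Qed.

Lemma RicStar_alpha2 : RicStar (component W alpha2) = E.
Proof.
apply/funext => p.
exact: (ricci_star_alpha2 n_ge3 (metric_trmx p) (metric_unitmx p)
  (curvature_scalar2 p) (curvature_scalar3 p)).
Qed.

Lemma Ric_pi2 : Ric (component W pi2) = E.
Proof.
apply/funext => p.
exact: (ricci_pi2 n_ge3 (metric_trmx p) (metric_unitmx p)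
  (curvature_scalar2 p) (curvature_scalar3 p)).
Qed.

Lemma RicStar_pi2 : RicStar (component W pi2) = - (n%:R - 1)^-1 *: E.
Proof.
apply/funext => p.
exact: (ricci_star_pi2 n_ge3 (metric_trmx p) (metric_unitmx p)
  (curvature_scalar2 p) (curvature_scalar3 p)).
Qed.

Lemma RicStar_pi5 : RicStar (component W pi5) = (n%:R / (n%:R - 1)) *: E.
Proof.
apply/funext => p.
exact: (ricci_star_pi5 n_ge3 (metric_trmx p) (metric_unitmx p)
  (curvature_scalar2 p) (curvature_scalar3 p)).
Qed.

Lemma Ric_alpha1 : Ric (component W alpha1) = Sym (Ric Rm) - E.
Proof.
apply/funext => p.
exact: (ricci_alpha1 (Rm p) n_ge3 (metric_trmx p) (metric_unitmx p)).
Qed.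

Lemma RicStar_alpha1 : RicStar (component W alpha1) = Sym (Ric Rm) - E.
Proof.
apply/funext => p.
exact: (ricci_star_alpha1 (Rm p) n_ge3 (metric_trmx p) (metric_unitmx p)).
Qed.

Lemma Ric0 : Ric (0 : W -> _) = 0.
Proof.
apply/funext => p; apply/funext => x; apply/funext => y.
by apply: big1 => i _; apply: big1 => j _; rewrite mulr0.
Qed.

Lemma RicStar0 : RicStar (0 : W -> _) = 0.
Proof.
apply/funext => p; apply/funext => x; apply/funext => y.
by apply: big1 => i _; apply: big1 => j _; rewrite mulr0.
Qed.

Lemma component_wedge0 P c r :
  (forall g A, P g A = c *: wedge r (tracefree_ricci g A) (inner g)) ->
  E = 0 -> component W P = 0.
Proof.
move=> PE E0; apply/funext => p; rewrite /component PE.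
by rewrite -[tracefree_ricci _ _]/(E p) E0 wedge0l scaler0.
Qed.

Lemma scaled_eq0 (c : R) : c != 0 -> c *: E = 0 <-> E = 0.
Proof.
move=> c0; split=> [cE0|->]; last exact: scaler0.
by apply: (scalerI c0); rewrite cE0 scaler0.
Qed.

Lemma RicStar_pi2_eq0 : RicStar (component W pi2) = 0 <-> E = 0.
Proof.
have [_ m1 _ _] := @dim_neq0 R n n_ge3.
by rewrite RicStar_pi2; apply: scaled_eq0; rewrite oppr_eq0 invr_eq0.
Qed.

Lemma RicStar_pi5_eq0 : RicStar (component W pi5) = 0 <-> E = 0.
Proof.
have [m0 m1 _ _] := @dim_neq0 R n n_ge3.
by rewrite RicStar_pi5; apply: scaled_eq0; rewrite mulf_neq0 ?invr_eq0.
Qed.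

Lemma alpha2_eq0 : component W alpha2 = 0 <-> E = 0.
Proof.
split=> [a0|]; first by rewrite -Ric_alpha2 a0 Ric0.
by apply: component_wedge0 => g A; exact: alpha2E.
Qed.

Lemma pi2_eq0 : component W pi2 = 0 <-> E = 0.
Proof.
split=> [a0|]; first by rewrite -Ric_pi2 a0 Ric0.
by apply: component_wedge0 => g A; exact: pi2E.
Qed.

(** The contraction Ric* must be used here: Ric annihilates E wedge_(n-1) g, the
    coefficient 1 - n + r being 0. *)
Lemma pi5_eq0 : component W pi5 = 0 <-> E = 0.
Proof.
split=> [a0|]; first by apply/RicStar_pi5_eq0; rewrite a0 RicStar0.
by apply: component_wedge0 => g A; exact: pi5E.
Qed.

Lemma A_sum_eq : Rm = component W alpha1 + component W alpha6
    + component W alpha4 + component W alpha5 <-> E = 0.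
Proof.
rewrite -alpha2_eq0; set s := (X in Rm = X).
have RmE : Rm = s + component W alpha2.
  by apply/funext => p; exact: A_decomposition.
split=> [Rms|a20]; last by rewrite [LHS]RmE a20 addr0.
by apply: (addrI s); rewrite -RmE Rms addr0.
Qed.

Lemma W_sum_eq : Rm = component W pi1 + component W pi3
    + component W pi4 + component W pi6 <-> E = 0.
Proof.
rewrite -alpha2_eq0; set s := (X in Rm = X).
have RmE : Rm = s + component W alpha2.
  by apply/funext => p; exact: W_decomposition.
split=> [Rms|a20]; last by rewrite [LHS]RmE a20 addr0.
by apply: (addrI s); rewrite -RmE Rms addr0.
Qed.

Lemma Sym_Ric_sub_eq : Sym (Ric Rm) - E = Sym (Ric Rm) <-> E = 0.
Proof.
split=> [SE|->]; last exact: subr0.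
by rewrite -[LHS](subKr (Sym (Ric Rm))) SE subrr.
Qed.

Lemma Ric_sub_eq :
  Sym (Ric Rm) - E = Ric Rm <-> einstein_weyl W /\ Alt (Ric Rm) = 0.
Proof.
have fiber p := tracefree_and_alt_eq0 (Rm p) (metric_trmx p).
split=> [SE|[/einstein_weylE E0 altR0]].
  have {}fiber p := (fiber p).2 (congr1 (@^~ p) SE).
  by split; [apply/einstein_weylE|]; apply/funext => p; have [] := fiber p.
apply/funext => p; apply/(fiber p); split.
  exact: (congr1 (@^~ p) E0).
exact: (congr1 (@^~ p) altR0).
Qed.

End WeylTensor.

Theorem proposition3p15 (R : realType) (n : nat) (hn : (3 <= n)%N)
    (W : weyl_manifold R n) :
  let Rm := curvature W in
  (* (12)-(15) hold with the symmetrized Ricci tensor; the versions with the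
     full Ricci tensor characterize Einstein-Weyl plus vanishing of the
     skew part of the Ricci tensor, see the second equivalence. *)
  [<-> (* (1) *) einstein_weyl W;
       (* (2) *) Rm = component W alpha1 + component W alpha6
                      + component W alpha4 + component W alpha5;
       (* (3) *) Rm = component W pi1 + component W pi3
                      + component W pi4 + component W pi6;
       (* (4) *) component W alpha2 = 0;
       (* (5) *) component W pi2 = 0;
       (* (6) *) component W pi5 = 0;
       (* (7) *) Ric (component W alpha2) = 0;
       (* (8) *) RicStar (component W alpha2) = 0;
       (* (9) *) Ric (component W pi2) = 0;
       (* (10) *) RicStar (component W pi2) = 0;
       (* (11) *) RicStar (component W pi5) = 0;
       (* (12) *) RicStar (component W alpha1) = Sym (Ric Rm);
       (* (13) *) Ric (component W pi1) = Sym (Ric Rm);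
       (* (14) *) RicStar (component W pi1) = Sym (Ric Rm);
       (* (15) *) Ric (component W alpha1) = Sym (Ric Rm)]
  /\
  [<-> einstein_weyl W /\ Alt (Ric Rm) = 0;
       (* (12) *) RicStar (component W alpha1) = Ric Rm;
       (* (13) *) Ric (component W pi1) = Ric Rm;
       (* (14) *) RicStar (component W pi1) = Ric Rm;
       (* (15) *) Ric (component W alpha1) = Ric Rm].
Proof.
move=> Rm; rewrite {}/Rm.
rewrite (propext (A_sum_eq W hn)) (propext (W_sum_eq W hn)).
rewrite (propext (alpha2_eq0 W hn)) (propext (pi2_eq0 W hn)).
rewrite (propext (pi5_eq0 W hn)) (propext (RicStar_pi2_eq0 W hn)).
rewrite (propext (RicStar_pi5_eq0 W hn)) Ric_alpha2 // RicStar_alpha2 //.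
rewrite Ric_pi2 // -![component W pi1]/(component W alpha1).
rewrite Ric_alpha1 // RicStar_alpha1 // (propext (Sym_Ric_sub_eq W)).
rewrite (propext (Ric_sub_eq W hn)) (propext (einstein_weylE W hn)).
by split; tfae.
Qed.
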